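(* Let $n,m,k$ be positive integers, $\lambda\ge0$, $A\in\mathbb{R}^{n\times m}$, $\Omega\subseteq[n]\times[m]$. For $i\in[n]$ let $H^i\in\mathbb{R}^{m\times m}$ be the diagonal matrix with $H^i_{j,j}=1$ if $(i,j)\in\Omega$ and $H^i_{j,j}=0$ otherwise. Define $\bar H:=\mathrm{Diag}(\bar h)$, where $\bar h_j:=\min_{i\in[n]}H^i_{j,j}$. Then the problem $$\begin{aligned}\min_{Y\in\mathrm{Conv}(\mathcal{Y}_n^k)}\ \min_{X\in\mathbb{R}^{n\times m},\,S^1,\dots,S^n\in\mathcal{S}^m_+}\quad & \sum_{i\in[n]}\langle S^i,H^i\rangle-2\langle\mathcal{P}(X),\mathcal{P}(A)\rangle+\langle\mathcal{P}(A),\mathcal{P}(A)\rangle+\lambda\,\mathrm{tr}(Y) \\ \text{s.t.}\quad & S^i\succeq X_{i,.}X_{i,.}^\top\ \ \forall i\in[n],\qquad\begin{pmatrix}\sum_{i\in[n]}S^i & X^\top \\ X & Y\end{pmatrix}\succeq0\end{aligned}$$ attains the same optimal value as $$\begin{aligned}\min_{Y\in\mathrm{Conv}(\mathcal{Y}_n^k)}\ \min_{X\in\mathbb{R}^{n\times m},\,\Theta\in\mathcal{S}^m_+}\quad & \langle\bar H,\Theta\rangle+\sum_{i\in[n]}\langle H^i-\bar H,X_{i,.}X_{i,.}^\top\rangle-2\langle\mathcal{P}(X),\mathcal{P}(A)\rangle+\langle\mathcal{P}(A),\mathcal{P}(A)\rangle+\lambda\,\mathrm{tr}(Y) \\ \text{s.t.}\quad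 & \begin{pmatrix}\Theta & X^\top \\ X & Y\end{pmatrix}\succeq0.\end{aligned}$$
   Context: $\mathcal{S}^d_+$ is the set of $d\times d$ real symmetric positive semidefinite matrices; $\langle\cdot,\cdot\rangle$ is the trace inner product; $[n]=\{1,\dots,n\}$; $X_{i,.}\in\mathbb{R}^m$ is the column vector containing the $i$th row of $X$. $\mathcal{P}$ is the linear map on $\mathbb{R}^{n\times m}$ with $\mathcal{P}(M)_{i,j}=M_{i,j}$ if $(i,j)\in\Omega$ and $0$ otherwise. $\mathcal{Y}_n^k:=\{Y\in\mathcal{S}^n_+:Y^2=Y,\ \mathrm{tr}(Y)\le k\}$, whose convex hull is $\mathrm{Conv}(\mathcal{Y}_n^k)=\{P\in\mathcal{S}^n_+:P\preceq I_n,\ \mathrm{tr}(P)\le k\}$. Optimal values are infima (not necessarily attained). *)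

(* Defs.v *)
From HB Require Import structures.
From mathcomp Require Import all_boot all_order all_algebra.
From mathcomp Require Import boolp classical_sets reals ereal convex.
Set Implicit Arguments.
Unset Strict Implicit.
Unset Printing Implicit Defensive.
Import Order.TTheory GRing.Theory Num.Theory.
Local Open Scope classical_set_scope.
Local Open Scope ring_scope.

Definition psd (R : realType) (d : nat) : set 'M[R]_d :=
  [set A | A^T = A /\ forall x : 'cV[R]_d, 0 <= (x^T *m A *m x) 0 0].

(* Loewner order: [loewner_le A B] is A ⪯ B *)
Definition loewner_le (R : realType) (d : nat) (A B : 'M[R]_d) : Prop :=
  psd (B - A).

Definition trace_inner (R : realType) (p q : nat) (A B : 'M[R]_(p, q)) : R :=
  \tr (A^T *m B).

Definition rowcol (R : realType) (n m : nat) (X : 'M[R]_(n, m)) (i : 'I_n)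
    : 'cV[R]_m :=
  (row i X)^T.

Definition mask_mx (R : realType) (n m : nat) (Omega : {set 'I_n * 'I_m})
    (M : 'M[R]_(n, m)) : 'M[R]_(n, m) :=
  \matrix_(i, j) if (i, j) \in Omega then M i j else 0.

(* Orthogonal projections of rank at most k (the rank being the trace) *)
Definition proj_set (R : realType) (n k : nat) : set 'M[R]_n :=
  [set Y | [/\ psd Y, Y *m Y = Y & \tr Y <= k%:R]].

Definition convex_hull (R : realType) (V : lmodType R) (A : set V) : set V :=
  smallest (@convex_set R V) A.

Definition Hmx (R : realType) (n m : nat) (Omega : {set 'I_n * 'I_m})
    (i : 'I_n) : 'M[R]_m :=
  diag_mx (\row_j ((i, j) \in Omega)%:R).

(* The entries being minimised are 0 or 1, so starting the iterated minimum
   at 1 does not affect its value when n > 0. *)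
Definition hbar (R : realType) (n m : nat) (Omega : {set 'I_n * 'I_m})
    : 'rV[R]_m :=
  \row_j \big[Num.min/1]_(i < n) Hmx R Omega i j j.

Definition Hbar (R : realType) (n m : nat) (Omega : {set 'I_n * 'I_m})
    : 'M[R]_m :=
  diag_mx (hbar R Omega).

(* Main.v *)
Require Import Defs.
From HB Require Import structures.
From mathcomp Require Import all_boot all_order all_algebra.
From mathcomp Require Import boolp classical_sets reals ereal convex.
From mathcomp Require Import ring lra.
Import Order.TTheory GRing.Theory Num.Theory.
Local Open Scope classical_set_scope.
Local Open Scope ring_scope.

(** The two problems are compared for a fixed [Y] and a fixed [X], with [x_i]
    the rows of [X] as column vectors. Put [S^i = x_i x_i^T + E_i] and
    [Theta = X^T X + D]. The summands [x_i x_i^T] add up to [X^T X] and are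
    charged [<H^i, x_i x_i^T>] in both problems ([objective_slack]). What
    remains is the cost [sum_i <H^i, E_i>] of the slacks on one side, and
    [<Hbar, D>] on the other.

    From the [S^i] to [Theta], take [D] to be the sum of the [E_i]: each mask
    [H^i] dominates [Hbar], so the cost can only drop ([trace_inner_Hbar_le]).

    Conversely, the block constraint together with [Y <= 1] (which holds on the
    convex hull of the projections) forces [D] to be positive semidefinite
    ([schur_slack]). It then suffices to find positive semidefinite [E_i] whose
    sum dominates [D], because enlarging the upper left block keeps the block
    matrix positive semidefinite. Coordinates outside the common mask are free
    for some row, so arbitrarily large weights can be put there; these absorb
    the off-diagonal blocks of [D] after an arbitrarily small inflation of its
    compression to the common coordinates ([split_slack]). The inflation is why
    the infima agree although attainment is not transferred. *)

(** * The positive semidefinite cone *)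

Lemma quad_formE {R : realType} {d : nat} (A : 'M[R]_d) (x : 'cV[R]_d) :
  (x^T *m A *m x) 0 0 = \sum_j \sum_i x i 0 * A i j * x j 0.
Proof.
rewrite mxE; apply: eq_bigr => j _; rewrite mxE big_distrl /=.
by apply: eq_bigr => i _; rewrite mxE.
Qed.

Lemma psd0 {R : realType} {d : nat} : psd (0 : 'M[R]_d).
Proof. by split=> [|x]; rewrite ?trmx0 // mulmx0 mul0mx mxE. Qed.

Lemma psdD {R : realType} {d : nat} (A B : 'M[R]_d) :
  psd A -> psd B -> psd (A + B).
Proof.
move=> [sA pA] [sB pB]; split=> [|x]; first by rewrite linearD /= sA sB.
by rewrite mulmxDr mulmxDl mxE addr_ge0 ?pA ?pB.
Qed.

Lemma psdZ {R : realType} {d : nat} (a : R) (A : 'M[R]_d) :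
  0 <= a -> psd A -> psd (a *: A).
Proof.
move=> a0 [sA pA]; split=> [|x]; first by rewrite linearZ /= sA.
by rewrite -scalemxAr -scalemxAl mxE mulr_ge0 ?pA.
Qed.

Lemma psd_sum {R : realType} {d : nat} (I : finType) (F : I -> 'M[R]_d) :
  (forall i, psd (F i)) -> psd (\sum_i F i).
Proof.
by move=> pF; apply: (big_ind (@psd R d)) => [|A B|i _] //;
  [exact: psd0|exact: psdD].
Qed.

(** The form of [B^T A B] at [x] is the form of [A] at [B x]. *)
Lemma psd_congr {R : realType} {p q : nat} (B : 'M[R]_(p, q)) (A : 'M[R]_p) :
  psd A -> psd (B^T *m A *m B).
Proof.
move=> [sA pA]; split=> [|x]; first by rewrite !trmx_mul trmxK sA mulmxA.
by have := pA (B *m x); rewrite trmx_mul !mulmxA.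
Qed.

Lemma psd_gram {R : realType} {p q : nat} (B : 'M[R]_(p, q)) :
  psd (B^T *m B).
Proof.
split=> [|x]; first by rewrite trmx_mul trmxK.
rewrite mulmxA -mulmxA -trmx_mul mxE sumr_ge0 // => i _.
by rewrite mxE -expr2 sqr_ge0.
Qed.

Lemma psd_diag {R : realType} {d : nat} (u : 'rV[R]_d) :
  (forall j, 0 <= u 0 j) -> psd (diag_mx u).
Proof.
move=> u0; split=> [|x]; first by rewrite tr_diag_mx.
rewrite mul_mx_diag mxE sumr_ge0 // => j _.
by rewrite !mxE mulrAC -expr2 mulr_ge0 ?sqr_ge0.
Qed.

Lemma psd_diag_ge0 {R : realType} {d : nat} (A : 'M[R]_d) (j : 'I_d) :
  psd A -> 0 <= A j j.
Proof.
move=> [_ /(_ (delta_mx j 0))].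
by rewrite trmx_delta -rowE -colE !mxE.
Qed.

Lemma psd_ul {R : realType} {m n : nat} (E : 'M[R]_m) :
  psd E -> psd (block_mx E 0 0 (0 : 'M[R]_n)).
Proof.
move=> /(psd_congr (row_mx 1%:M (0 : 'M[R]_(m, n)))).
rewrite tr_row_mx trmx1 trmx0 mul_col_mx mul1mx mul0mx mul_col_row.
by rewrite mulmx1 mulmx0 !mul0mx.
Qed.

(** The entries of A dominate its quadratic form crudely: each monomial is at
    most |A i j| times the squared norm of the vector. *)
Lemma exists_loewner_scalar {R : realType} {d : nat} (A : 'M[R]_d) :
  A^T = A -> exists2 c : R, 0 <= c & psd (c%:M - A).
Proof.
move=> sA; exists (\sum_j \sum_i `|A i j|).
  by do 2!apply: sumr_ge0 => ? _.
split=> [|x]; first by rewrite linearB /= tr_scalar_mx sA.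
rewrite mulmxBr mulmxBl mul_mx_scalar -scalemxAl [X in _ <= X]mxE.
rewrite [X in _ <= X + _]mxE [X in _ <= _ + X]mxE quad_formE subr_ge0.
have xE : (x^T *m x) 0 0 = \sum_i x i 0 ^+ 2.
  by rewrite mxE; apply: eq_bigr => i _; rewrite mxE expr2.
have xi i : x i 0 ^+ 2 <= (x^T *m x) 0 0.
  by rewrite xE (bigD1 i) //= lerDl sumr_ge0 // => ? _; rewrite sqr_ge0.
rewrite mulr_suml ler_sum // => j _; rewrite mulr_suml ler_sum // => i _.
apply: le_trans (ler_norm _) _; rewrite !normrM mulrAC mulrC ler_wpM2l //.
have := xi i; have := xi j; rewrite -(real_normK (num_real (x i 0))).
rewrite -(real_normK (num_real (x j 0))).
by have := sqr_ge0 (`|x i 0| - `|x j 0|); nra.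
Qed.

(** * The trace inner product *)

Lemma trace_innerC {R : realType} {p q : nat} (A B : 'M[R]_(p, q)) :
  trace_inner A B = trace_inner B A.
Proof. by rewrite /trace_inner -mxtrace_tr trmx_mul trmxK. Qed.

Lemma trace_innerDr {R : realType} {p q : nat} (A B C : 'M[R]_(p, q)) :
  trace_inner A (B + C) = trace_inner A B + trace_inner A C.
Proof. by rewrite /trace_inner mulmxDr mxtraceD. Qed.

Lemma trace_innerBr {R : realType} {p q : nat} (A B C : 'M[R]_(p, q)) :
  trace_inner A (B - C) = trace_inner A B - trace_inner A C.
Proof. by rewrite /trace_inner mulmxBr raddfB. Qed.

Lemma trace_inner_sumr {R : realType} {p q : nat} (I : finType)
    (A : 'M[R]_(p, q)) (F : I -> 'M[R]_(p, q)) :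
  trace_inner A (\sum_i F i) = \sum_i trace_inner A (F i).
Proof. by rewrite /trace_inner mulmx_sumr raddf_sum. Qed.

Lemma trace_inner_diag {R : realType} {d : nat} (u : 'rV[R]_d) (A : 'M[R]_d) :
  trace_inner (diag_mx u) A = \sum_j u 0 j * A j j.
Proof.
rewrite /trace_inner tr_diag_mx mul_diag_mx.
by apply: eq_bigr => j _; rewrite mxE.
Qed.

(** * The common mask and the individual masks *)

(** The masks have entries 0 and 1, so their minimum is the indicator of the
    columns observed in every row. *)
Lemma hbarE {R : realType} {n m : nat} (Omega : {set 'I_n * 'I_m}) (j : 'I_m) :
  hbar R Omega 0 j = [forall i, (i, j) \in Omega]%:R.
Proof.
have HE i : Hmx R Omega i j j = ((i, j) \in Omega)%:R.
  by rewrite !mxE eqxx mulr1n.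
rewrite mxE; case: forallP => [all_in|/forallP].
  apply: (big_ind (fun z : R => z = 1)) => [|a b -> ->|i _] //.
    by rewrite minxx.
  by rewrite HE all_in.
rewrite negb_forall => /existsP[i ni]; apply/le_anti/andP; split.
  by apply: (@bigmin_inf _ _ _ _ i) => //; rewrite HE (negbTE ni).
by apply/bigmin_geP; split=> [|k _]; rewrite ?ler01 ?HE ?ler0n.
Qed.

Lemma hbar_ge0 {R : realType} {n m : nat} (Omega : {set 'I_n * 'I_m}) j :
  0 <= hbar R Omega 0 j.
Proof. by rewrite hbarE ler0n. Qed.

Lemma hbar_le {R : realType} {n m : nat} (Omega : {set 'I_n * 'I_m}) i j :
  hbar R Omega 0 j <= ((i, j) \in Omega)%:R.
Proof. by rewrite hbarE ler_nat; case: forallP => // ->. Qed.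

(** A column missing from the common mask is missing from at least one
    individual mask; this is where the free diagonal weight of the splitting
    comes from. *)
Lemma hbar_gap {R : realType} {n m : nat} (Omega : {set 'I_n * 'I_m}) j :
  1 - hbar R Omega 0 j <= \sum_(i < n) (1 - ((i, j) \in Omega)%:R).
Proof.
have ge0 (i : 'I_n) : 0 <= 1 - ((i, j) \in Omega)%:R :> R.
  by rewrite subr_ge0 lern1 leq_b1.
rewrite hbarE; case: forallP => [_|/forallP].
  by rewrite subrr sumr_ge0.
rewrite negb_forall => /existsP[i ni]; rewrite (bigD1 i) //= (negbTE ni).
by rewrite lerDl sumr_ge0.
Qed.

(** * Splitting the slack among the rows *)

(** Young's inequality for the cross terms of [D = (P + Q) D (P + Q)]: the
    difference of the two sides is a perfect square,
    [delta^-1 (delta P - Q) D (delta P - Q)]. *)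
Lemma young_compress {R : realType} {d : nat} (D : 'M[R]_d) (u : 'rV[R]_d)
    (delta : R) :
  0 < delta -> psd D ->
  let P := diag_mx u in let Q := diag_mx (const_mx 1 - u) in
  psd ((1 + delta) *: (P *m D *m P) + (1 + delta^-1) *: (Q *m D *m Q) - D).
Proof.
move=> d0 pD P Q.
pose B := diag_mx (delta *: u - (const_mx 1 - u)).
suff -> : (1 + delta) *: (P *m D *m P) + (1 + delta^-1) *: (Q *m D *m Q) - D
    = delta^-1 *: (B^T *m D *m B).
  by apply: psdZ; [rewrite invr_ge0 ltW|exact: psd_congr].
rewrite /P /Q tr_diag_mx /B; apply/matrixP => i j.
rewrite !mul_mx_diag !mul_diag_mx !mxE.
by field; rewrite gt_eqF.
Qed.

(** The key step. Let [P] be the common mask and [Q = 1 - P]. By Young's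
    inequality [D] is at most [(1 + delta) P D P] plus a large multiple of [Q].
    The first part costs the same under every mask, since each mask is 1
    wherever [P] is. The second part is free: [Q] is dominated by the sum over
    [i] of [1 - H^i], and [1 - H^i] costs nothing under [H^i]. Only the factor
    [1 + delta] is lost. *)
Lemma split_slack {R : realType} {n m : nat} (n_gt0 : (0 < n)%N)
    (Omega : {set 'I_n * 'I_m}) (D : 'M[R]_m) (e : R) :
  0 < e -> psd D ->
  exists E : 'I_n -> 'M[R]_m,
  [/\ forall i, psd (E i), psd (\sum_i E i - D)
    & \sum_i trace_inner (Hmx R Omega i) (E i)
      <= trace_inner (Hbar R Omega) D + e].
Proof.
move=> e0 pD; set K := trace_inner (Hbar R Omega) D.
have K0 : 0 <= K.
  rewrite /K trace_inner_diag sumr_ge0 // => j _.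
  by rewrite mulr_ge0 ?hbar_ge0 ?psd_diag_ge0.
(* With this delta the excess cost delta * K is at most e. *)
pose delta := e / (1 + K).
have d0 : 0 < delta by rewrite divr_gt0 // ltr_pwDl.
have [c c0 pc] := exists_loewner_scalar D (proj1 pD).
pose u : 'rV[R]_m := \row_j [forall i, (i, j) \in Omega]%:R.
have uE : hbar R Omega = u by apply/rowP => j; rewrite hbarE mxE.
pose s := (1 + delta^-1) * c.
pose v (i : 'I_n) : 'rV[R]_m := \row_j (1 - ((i, j) \in Omega)%:R).
pose P := diag_mx u; pose Q := diag_mx (const_mx 1 - u).
have s0 : 0 <= s by rewrite mulr_ge0 // addr_ge0 // invr_ge0 ltW.
have d1 : 0 <= 1 + delta by rewrite addr_ge0 // ltW.
have pPDP : psd (P *m D *m P) by have := psd_congr P D pD; rewrite tr_diag_mx.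
have n0 : n%:R != 0 :> R by rewrite pnatr_eq0 -lt0n.
(* The free weights of row i, and an equal share of the inflated P D P. *)
pose E i := s *: diag_mx (v i) + ((1 + delta) / n%:R) *: (P *m D *m P).
exists E; split=> [i||].
- apply: psdD; apply: psdZ => //; last by rewrite mulr_ge0 // invr_ge0.
  by apply: psd_diag => j; rewrite mxE subr_ge0 lern1 leq_b1.
- have sumE : \sum_i E i
      = s *: diag_mx (\sum_i v i) + (1 + delta) *: (P *m D *m P).
    rewrite big_split /= sumr_const card_ord -scaler_sumr.
    rewrite [diag_mx (\sum_i _)]raddf_sum /=; congr (_ + _).
    by rewrite -scaler_nat scalerA mulrC divfK.
  (* Three nonnegative terms: the surplus of the free weights over Q, the
     scalar bound c on D compressed by Q, and Young's inequality. *)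
  have -> : \sum_i E i - D
    = s *: diag_mx (\sum_i v i - (const_mx 1 - u))
      + (1 + delta^-1) *: (Q^T *m (c%:M - D) *m Q)
      + ((1 + delta) *: (P *m D *m P) + (1 + delta^-1) *: (Q *m D *m Q) - D).
    rewrite sumE tr_diag_mx mulmxBr mulmxBl scalerBr.
    have -> : (1 + delta^-1) *: (Q *m c%:M *m Q)
        = s *: diag_mx (const_mx 1 - u).
      rewrite mul_mx_scalar -scalemxAl scalerA; congr (_ *: _).
      rewrite mul_diag_mx; apply/matrixP => a b; rewrite !mxE.
      case: eqP => [->|_]; last by rewrite !mulr0n mulr0.
      by case: [forall _, _]; rewrite !mulr1n /= ?subrr ?subr0 ?mulr0 ?mulr1.
    rewrite [diag_mx (_ - _)]raddfB /= scalerBr -/Q.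
    by apply/matrixP => a b; rewrite !mxE; ring.
  apply: psdD; last exact: young_compress.
  apply: psdD; apply: psdZ => //; last exact: psd_congr.
    apply: psd_diag => j; rewrite !mxE summxE subr_ge0.
    by under eq_bigr do rewrite mxE; rewrite -hbarE; exact: hbar_gap.
  by rewrite addr_ge0 // invr_ge0 ltW.
- have cost i : trace_inner (Hmx R Omega i) (E i) = (1 + delta) * K / n%:R.
    rewrite /K /Hbar uE !trace_inner_diag mulrAC mulr_sumr.
    apply: eq_bigr => j _.
    rewrite /E /P mul_mx_diag mul_diag_mx !mxE eqxx mulr1n.
    (* Only the two indicators matter: the common one implies the other. *)
    have := @hbar_le R _ _ Omega i j; rewrite hbarE.
    move: [forall _, _] ((i, j) \in Omega) => a b.
    by rewrite ler_nat; case: a; case: b => //= _; ring.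
  rewrite (eq_bigr _ (fun i _ => cost i)) sumr_const card_ord.
  rewrite -[_ *+ n]mulr_natr divfK //.
  rewrite mulrDl mul1r lerD2l /delta mulrAC ler_pdivrMr ?ltr_pwDl //.
  by rewrite ler_pM2l // lerDr.
Qed.

(** * Feasibility and objectives in terms of the slack *)

(** The matrices below the identity form a convex set, and it contains every
    orthogonal projection [Y] because [1 - Y] is symmetric and idempotent,
    hence a Gram matrix. *)
Lemma hull_loewner_le1 {R : realType} {n k : nat} (Y : 'M[R]_n) :
  convex_hull (@proj_set R n k) Y -> loewner_le Y 1%:M.
Proof.
move: Y.
change (convex_hull (@proj_set R n k) `<=` [set Y | loewner_le Y 1%:M]).
apply: smallest_sub => [A B t|Y [[sY _] YY _]].
  rewrite !inE /= => pA pB.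
  have -> : loewner_le (conv t A B) 1%:M
    = psd (t%:num *: (1%:M - A) + (1 - t%:num) *: (1%:M - B)).
    congr (psd _).
    by apply/matrixP => i j; rewrite !mxE /= /unstable.onem; ring.
  by apply: psdD; apply: psdZ => //; rewrite subr_ge0.
have := psd_gram (1%:M - Y); rewrite [(_ - _)^T]linearB /= trmx1 sY.
by rewrite mulmxBr mulmx1 mulmxBl mul1mx YY subrr subr0.
Qed.

(** Testing the block matrix on the vectors [(x, - X x)] bounds [Theta] below
    by [2 X^T X - X^T Y X], and [Y] is at most the identity. *)
Lemma schur_slack {R : realType} {n m : nat} (Theta : 'M[R]_m)
    (X : 'M[R]_(n, m)) (Y : 'M[R]_n) :
  loewner_le Y 1%:M -> psd (block_mx Theta X^T X Y) -> psd (Theta - X^T *m X).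
Proof.
move=> pY /(psd_congr (col_mx 1%:M (- X))).
rewrite tr_col_mx trmx1 -mulmxA mul_block_col !mulmx1 mul_row_col mul1mx.
rewrite [(- X)^T]linearN /= => /(psdD _ _ (psd_congr X _ pY)).
congr psd.
rewrite mulmxBr mulmx1 mulmxBl !mulmxN mulNmx mulmxDr mulmxN mulmxA.
by apply/matrixP => i j; rewrite !mxE; ring.
Qed.

Lemma gram_rows {R : realType} {n m : nat} (X : 'M[R]_(n, m)) :
  X^T *m X = \sum_i rowcol X i *m (rowcol X i)^T.
Proof.
apply/matrixP => a b; rewrite mxE summxE; apply: eq_bigr => i _.
by rewrite !mxE big_ord1 !mxE.
Qed.

(** Writing [Theta = X^T X + D], the terms in [Hbar] that involve [X] cancel,
    and the slack [D] is the only matrix charged at the common rate. *)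
Lemma objective_slack {R : realType} {n m : nat} (Omega : {set 'I_n * 'I_m})
    (X : 'M[R]_(n, m)) (Theta : 'M[R]_m) :
  trace_inner (Hbar R Omega) Theta
  + \sum_i trace_inner (Hmx R Omega i - Hbar R Omega)
             (rowcol X i *m (rowcol X i)^T)
  = \sum_i trace_inner (Hmx R Omega i) (rowcol X i *m (rowcol X i)^T)
    + trace_inner (Hbar R Omega) (Theta - X^T *m X).
Proof.
rewrite trace_innerBr gram_rows trace_inner_sumr.
rewrite [RHS]addrCA -sumrB; congr (_ + _); apply: eq_bigr => i _.
by rewrite trace_innerC trace_innerBr !(trace_innerC (_ *m _)).
Qed.

Lemma trace_inner_Hbar_le {R : realType} {n m : nat}
    (Omega : {set 'I_n * 'I_m}) i (E : 'M[R]_m) :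
  psd E -> trace_inner (Hbar R Omega) E <= trace_inner (Hmx R Omega i) E.
Proof.
move=> pE; rewrite !trace_inner_diag ler_sum // => j _.
rewrite [in leRHS]mxE.
by rewrite ler_wpM2r ?psd_diag_ge0 ?hbar_le.
Qed.

Theorem proposition5 (R : realType) (n m k : nat)
    (n_gt0 : (0 < n)%N) (m_gt0 : (0 < m)%N) (k_gt0 : (0 < k)%N)
    (lambda : R) (lambda_ge0 : 0 <= lambda)
    (A : 'M[R]_(n, m)) (Omega : {set 'I_n * 'I_m}) :
  ereal_inf
    [set ereal_inf
      [set v : \bar R |
        exists (X : 'M[R]_(n, m)) (S : 'I_n -> 'M[R]_m),
        [/\ forall i, psd (S i),
            forall i, loewner_le (rowcol X i *m (rowcol X i)^T) (S i),
            psd (block_mx (\sum_(i < n) S i) X^T X Y)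
          & v = (\sum_(i < n) trace_inner (S i) (Hmx R Omega i)
                 - 2 * trace_inner (mask_mx Omega X) (mask_mx Omega A)
                 + trace_inner (mask_mx Omega A) (mask_mx Omega A)
                 + lambda * \tr Y)%:E]]
    | Y in convex_hull (@proj_set R n k)]
  =
  ereal_inf
    [set ereal_inf
      [set v : \bar R |
        exists (X : 'M[R]_(n, m)) (Theta : 'M[R]_m),
        [/\ psd Theta,
            psd (block_mx Theta X^T X Y)
          & v = (trace_inner (Hbar R Omega) Theta
                 + \sum_(i < n) trace_inner (Hmx R Omega i - Hbar R Omega)
                                  (rowcol X i *m (rowcol X i)^T)
                 - 2 * trace_inner (mask_mx Omega X) (mask_mx Omega A)
                 + trace_inner (mask_mx Omega A) (mask_mx Omega A)
                 + lambda * \tr Y)%:E]]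
    | Y in convex_hull (@proj_set R n k)].
Proof.
congr ereal_inf; apply: eq_imagel => Y /hull_loewner_le1 Y1.
apply/le_anti/andP; split; apply: le_ereal_inf_tmp => v.
  (* Every value of the second problem is approached within e by one of the
     first. *)
  move=> [X [Theta [pT pB ->]]]; apply/lee_addgt0Pr => e e0.
  have [E [pE pSE costE]] :=
    split_slack n_gt0 Omega _ _ e0 (schur_slack _ _ _ Y1 pB).
  apply: ge_ereal_inf.
  pose S i := rowcol X i *m (rowcol X i)^T + E i.
  have ps i : psd (rowcol X i *m (rowcol X i)^T).
    by rewrite -{1}[rowcol X i]trmxK; exact: psd_gram.
  eexists.
    exists X, S; split=> [i|i||]; last by reflexivity.
    - exact: psdD.
    - by rewrite /loewner_le /S addrC addKr.
    - have -> : block_mx (\sum_i S i) X^T X Y = block_mx Theta X^T X Y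
          + block_mx (\sum_i E i - (Theta - X^T *m X)) 0 0 0.
        rewrite add_block_mx !addr0 big_split /= -gram_rows; congr block_mx.
        by apply/matrixP => a b; rewrite !mxE; ring.
      by apply: psdD => //; exact: psd_ul.
  rewrite -EFinD lee_fin objective_slack.
  have -> : \sum_i trace_inner (S i) (Hmx R Omega i)
      = \sum_i trace_inner (Hmx R Omega i) (rowcol X i *m (rowcol X i)^T)
        + \sum_i trace_inner (Hmx R Omega i) (E i).
    rewrite -big_split; apply: eq_bigr => i _.
    by rewrite trace_innerC trace_innerDr.
  by move: costE; lra.
move=> [X [S [pS pSX pB ->]]]; apply: ge_ereal_inf.
eexists.
  exists X, (\sum_i S i); split; [exact: psd_sum|exact: pB|reflexivity].
rewrite lee_fin objective_slack gram_rows -sumrB trace_inner_sumr -big_split /=.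
rewrite !lerD2r ler_sum // => i _.
have := trace_inner_Hbar_le Omega i _ (pSX i).
by rewrite [leRHS]trace_innerBr [trace_inner (S i) _]trace_innerC; lra.
Qed.
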